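(* There exists a function $f:\mathbb{N}\to\mathbb{N}$ such that the following holds. Let $m$ be a positive integer and let $G$ be a (possibly infinite) group covered by $m$ cyclic subgroups, i.e. $G$ is the union of $m$ cyclic subgroups. Then $G$ has a finite normal subgroup $\Delta$ of order at most $f(m)$ such that $G/\Delta$ is cyclic.
   Context: The function $f$ expresses that the order of $\Delta$ is ''$m$-bounded'', i.e. bounded by a function of $m$ only. Here $G$ is not assumed to be finite. *)

(* Defs.v *)
From HB Require Import structures.
From mathcomp Require Import all_boot ssralg ssrint.
From mathcomp Require Import boolp classical_sets functions cardinality.

Set Implicit Arguments.
Unset Strict Implicit.
Unset Printing Implicit Defensive.

Local Open Scope classical_set_scope.
Local Open Scope group_scope.
Local Open Scope quotient_scope.

(* MathComp's [groupType] allows infinite groups, but the cyclic subgroups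
   <[x]> and the quotients G / H of the library are those of finite groups;
   hence the following definitions. *)

Definition expgz (G : groupType) (x : G) (k : int) : G :=
  match k with Posz n => x ^+ n | Negz n => x ^- n.+1 end.

Definition cycle_set (G : groupType) (x : G) : set G := range (expgz x).

Definition cyclic_subgroup (G : groupType) (H : set G) : Prop :=
  exists x, H = cycle_set x.

Definition cyclic_group (G : groupType) : Prop := cyclic_subgroup [set: G].

Definition covered_by_cyclic (G : groupType) (m : nat) : Prop :=
  exists2 C : 'I_m -> set G,
    forall i, cyclic_subgroup (C i) & \bigcup_i C i = [set: G].

Record normalSubgroup (G : groupType) := NormalSubgroup {
  normal_set :> set G;
  normal_group_closed : group_closed [in normal_set];
  normal_conjg : {in normal_set, forall x y, x ^ y \in normal_set}
}.

Section Quotient.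
Variables (G : groupType) (N : normalSubgroup G).
Implicit Types x y z : G.

Let N1 : 1 \in normal_set N := (normal_group_closed N).1.

Let NM : mulg_closed [in normal_set N] :=
  group_closedM (normal_group_closed N).

Let NV : invg_closed [in normal_set N] :=
  group_closedV (normal_group_closed N).

(* [cosetr x y] iff x N = y N *)
Definition cosetr x y : bool := x^-1 * y \in normal_set N.

Fact cosetr_refl : reflexive cosetr.
Proof. by move=> x; rewrite /cosetr mulVg. Qed.

Fact cosetr_sym : symmetric cosetr.
Proof.
by move=> x y; apply/idP/idP => /NV; rewrite invgM invgK.
Qed.

Fact cosetr_trans : transitive cosetr.
Proof.
by move=> y x z Nxy Nyz; have := NM Nxy Nyz; rewrite !mulgA mulgK.
Qed.

Canonical cosetr_equiv :=
  EquivRel cosetr cosetr_refl cosetr_sym cosetr_trans.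

Definition quotg := {eq_quot cosetr_equiv}.

HB.instance Definition _ := Choice.on quotg.

Definition quotg_one : quotg := lift_cst quotg 1.
Definition quotg_inv := lift_op1 quotg (fun x : G => x^-1).
Definition quotg_mul := lift_op2 quotg (fun x y : G => x * y).

Canonical pi_quotg_one_morph := PiConst quotg_one.

Let Nrepr x : x^-1 * repr (\pi_quotg x) \in normal_set N.
Proof. by rewrite -[_ \in _]/(cosetr_equiv _ _) -eqmodE reprK. Qed.

Fact pi_quotg_inv : {morph \pi : x / x^-1 >-> quotg_inv x}.
Proof.
move=> x; unlock quotg_inv; apply/eqP; rewrite piE /= /cosetr.
have := normal_conjg (NV (Nrepr x)) x^-1.
by rewrite conjgE invgM !invgK !mulgA mulgK.
Qed.
Canonical pi_quotg_inv_morph := PiMorph1 pi_quotg_inv.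

Fact pi_quotg_mul : {morph \pi : x y / x * y >-> quotg_mul x y}.
Proof.
move=> x y; unlock quotg_mul; apply/eqP; rewrite piE /= /cosetr.
have := NM (normal_conjg (Nrepr x) y) (Nrepr y).
by rewrite conjgE invgM !mulgA mulgK.
Qed.
Canonical pi_quotg_mul_morph := PiMorph2 pi_quotg_mul.

Fact quotg_mulA : associative quotg_mul.
Proof.
by elim/quotW=> x; elim/quotW=> y; elim/quotW=> z; rewrite !piE mulgA.
Qed.

Fact quotg_mul1g : left_id quotg_one quotg_mul.
Proof. by elim/quotW=> x; rewrite !piE mul1g. Qed.

Fact quotg_mulg1 : right_id quotg_one quotg_mul.
Proof. by elim/quotW=> x; rewrite !piE mulg1. Qed.

Fact quotg_mulVg : left_inverse quotg_one quotg_inv quotg_mul.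
Proof. by elim/quotW=> x; rewrite !piE mulVg. Qed.

Fact quotg_mulgV : right_inverse quotg_one quotg_inv quotg_mul.
Proof. by elim/quotW=> x; rewrite !piE mulgV. Qed.

HB.instance Definition _ := isGroup.Build quotg
  quotg_mulA quotg_mul1g quotg_mulg1 quotg_mulVg quotg_mulgV.

Definition cosetg (x : G) : quotg := \pi_quotg x.

Fact cosetgM : {morph cosetg : x y / x * y}.
Proof. exact: pi_quotg_mul. Qed.

Fact cosetg_eqP x y :
  reflect (cosetg x = cosetg y) (x^-1 * y \in normal_set N).
Proof. by apply: (iffP idP) => [h|/eqP]; [apply/eqP|]; rewrite piE. Qed.

Fact cosetg_surj (u : quotg) : exists x, u = cosetg x.
Proof. by exists (repr u); rewrite /cosetg reprK. Qed.

End Quotient.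

(* Main.v *)
Require Import Defs.
From mathcomp Require Import all_boot finmap.
From mathcomp Require Import ssralg ssrint intdiv boolp.
From mathcomp Require Import classical_sets functions cardinality.

(** Let G be the union of the cyclic subgroups generated by x_1, ..., x_m.

    Every (m!)-th power is central: among the elements g, g y, ..., g y^m, two
    lie in the same cyclic subgroup, so they commute; hence g commutes with
    some y^d with 0 < d <= m, and d divides m!
    ([cyclic_cover_central_power]).

    By an argument of B. H. Neumann, one of the covering subgroups has
    m-bounded index ([coset_cover_finite_index]). So for some x_i the subgroup
    Z generated by z = x_i^(m!) is central, cyclic, and of m-bounded index n.

    The transfer G -> Z is a morphism that restricts to c |-> c^n on Z. Its
    kernel Delta has a cyclic quotient, isomorphic to a subgroup of Z. Each
    coset of Z meets Delta in at most as many elements as the n-torsion of the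
    cyclic group Z has, that is at most n, so that Delta has order at most
    n^2 ([central_cycle_quotient]). *)

Set Implicit Arguments.
Unset Strict Implicit.
Unset Printing Implicit Defensive.

Local Open Scope card_scope.
Local Open Scope classical_set_scope.
Local Open Scope group_scope.

(** * Integer powers and cyclic subgroups *)

Lemma expgzSr (G : groupType) (x : G) (k : int) :
  expgz x (k + 1)%R = expgz x k * x.
Proof.
case: k => [n|[|n]].
- by rewrite -[(Posz n + 1)%R]/(Posz (n + 1)) addn1 /= expgSr.
- by rewrite /= expg1 mulVg.
- rewrite (_ : _ + _ = Negz n)%R; last first.
    by rewrite !NegzE -[in LHS]addn1 PoszD GRing.opprD GRing.subrK.
  by rewrite /= [x ^+ n.+2]expgS invgM mulgVK.
Qed.

Lemma expgzD (G : groupType) (x : G) (k l : int) :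
  expgz x (k + l)%R = expgz x k * expgz x l.
Proof.
elim/int_ind: l => [|l IH|l IH]; first by rewrite GRing.addr0 mulg1.
  by rewrite -addn1 PoszD GRing.addrA !expgzSr IH mulgA.
apply: (mulIg x); rewrite -expgzSr -mulgA -expgzSr -GRing.addrA.
by rewrite -addn1 PoszD GRing.opprD GRing.subrK IH.
Qed.

Lemma expgzN (G : groupType) (x : G) (k : int) :
  expgz x (- k)%R = (expgz x k)^-1.
Proof. by apply: (mulIg (expgz x k)); rewrite -expgzD GRing.addNr mulVg. Qed.

Lemma expgzM (G : groupType) (x : G) (k l : int) :
  expgz x (k * l)%R = expgz (expgz x k) l.
Proof.
elim/int_ind: l => [|l IH|l IH]; first by rewrite GRing.mulr0.
  by rewrite -addn1 PoszD GRing.mulrDr GRing.mulr1 (expgzD x) IH expgzSr.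
apply: (mulIg (expgz x k)).
rewrite -(expgzD x) -expgzSr -addn1 PoszD GRing.opprD.
by rewrite GRing.subrK GRing.mulrDr GRing.mulrN1 GRing.subrK IH.
Qed.

(** Euclidean division in the exponent: a cyclic group is covered by the first
    [n] powers of a generator times the subgroup of [n]-th powers. If
    [x ^+ n = 1], only these first powers remain. *)
Lemma expgz_mod (G : groupType) (x : G) (n : nat) (k : int) : (0 < n)%N ->
  exists2 j, j \in iota 0 n & expgz x k = x ^+ j * expgz (x ^+ n) (k %/ n)%Z.
Proof.
move=> n_gt0; have n0 : Posz n != 0%R by rewrite -lt0n.
have kn : Posz `|(k %% n)%Z|%N = (k %% n)%Z by rewrite gez0_abs ?modz_ge0.
exists `|(k %% n)%Z|%N; first by rewrite mem_iota /= -ltz_nat kn ltz_pmod.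
rewrite [in LHS](divz_eq k n) GRing.addrC expgzD GRing.mulrC expgzM.
by rewrite -kn.
Qed.

Lemma expg1z (G : groupType) (k : int) : expgz (1 : G) k = 1.
Proof. by case: k => n /=; rewrite expg1n ?invg1. Qed.

Lemma commute_expgz (G : groupType) (x y : G) (k : int) :
  commute x y -> commute x (expgz y k).
Proof.
by move=> xy; case: k => n /=; [|apply: commuteV]; apply: commuteX.
Qed.

Lemma cycle_set_group (G : groupType) (x : G) :
  group_closed [in cycle_set x].
Proof.
split=> [|_ _ /set_mem[k _ <-] /set_mem[l _ <-]]; apply: mem_set.
  by exists 0%R.
by exists (k - l)%R => //; rewrite expgzD expgzN.
Qed.

Lemma group_expgz (G : groupType) (A : set G) (x : G) (k : int) :
  group_closed [in A] -> x \in A -> expgz x k \in A.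
Proof.
move=> gA Ax; have AX n : x ^+ n \in A.
  elim: n => [|n IH]; first exact: gA.1.
  by rewrite expgS; exact: (group_closedM gA).
by case: k => n //=; apply: (group_closedV gA).
Qed.

(** The generator is the least positive power of [x] that lies in [A], by
    Euclidean division; if there is none, [A] is trivial. *)
Lemma subgroup_of_cyclic (G : groupType) (x : G) (A : set G) :
  group_closed [in A] -> A `<=` cycle_set x -> cyclic_subgroup A.
Proof.
move=> gA Ax.
have AZ k : A (expgz x k) -> expgz x `|k|%N \in A.
  move/mem_set=> Ak; case: (intP k) Ak => [//|n //|n].
  by rewrite abszN expgzN => /(group_closedV gA); rewrite /= invgK.
have [[n Pn]|nP] := pselect (exists n, (0 < n)%N && (expgz x n \in A)).
  have /ex_minnP[d /andP[d_gt0 Ad] dmin] :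
      exists n, (0 < n)%N && (expgz x n \in A).
    by exists n.
  exists (expgz x d); apply/seteqP; split=> [a Aa|_ [k _ <-]]; last first.
    exact/set_mem/group_expgz.
  have [k _ defa] := Ax _ Aa; exists (k %/ d)%Z => //.
  have Ar : A (expgz x (k %% d)%Z).
    rewrite /modz expgzD expgzN GRing.mulrC expgzM; apply/set_mem.
    by apply: gA.2; [rewrite defa; apply: mem_set | apply: group_expgz].
  have r0 : (k %% d)%Z = 0%R.
    have d0 : Posz d != 0%R by rewrite -lt0n.
    apply/eqP; rewrite -absz_eq0 -leqn0 leqNgt; apply/negP=> r_gt0.
    have := dmin `|(k %% d)%Z|%N; rewrite r_gt0 AZ // => /(_ isT).
    rewrite leqNgt -ltz_nat gez0_abs ?modz_ge0 //.
    by rewrite ltz_pmod.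
  by rewrite -defa [in RHS](divz_eq k d) r0 GRing.addr0 GRing.mulrC expgzM.
exists 1; apply/seteqP; split=> [a Aa|_ [k _ <-]]; last first.
  exact/set_mem/(group_expgz _ gA)/gA.1.
have [k _ defa] := Ax _ Aa; exists 0%R => //=.
rewrite -defa; case: (posnP `|k|%N) => [/eqP|k_gt0].
  by rewrite absz_eq0 => /eqP->.
by case: nP; exists `|k|%N; rewrite k_gt0 AZ // defa.
Qed.

(** * Coset covers: a subgroup of bounded index *)

Definition coset_cover (G : groupType) (A : set G) (T : seq G) :=
  forall g, exists2 a, a \in T & A (a^-1 * g).

(** Neumann's lemma, with an explicit bound. All subgroups of the cover share
    one list [T] of representatives, which makes the induction on their number
    uniform. If [T] does not represent all cosets of the first subgroup [H i],
    let [b] be an element it misses. The coset [b H i] is then covered by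
    cosets of the other subgroups, and translating this cover by [a * b^-1]
    covers [a H i]; so [H i] can be dropped after replacing [T], of size [n],
    by a list of size [n + n ^ 2]. With no subgroup left, nothing would cover
    [1], so the process stops at a subgroup all of whose cosets are
    represented. *)
Lemma coset_cover_finite_index (G : groupType) (I : eqType)
    (H : I -> set G) (s : seq I) (T : seq G) :
    (forall i, i \in s -> group_closed [in H i]) ->
    (forall g, exists2 i, i \in s & exists2 a, a \in T & H i (a^-1 * g)) ->
  exists2 i, i \in s & exists2 U : seq G,
    (size U <= iter (size s) (fun n => n + n ^ 2)%N (size T))%N &
    coset_cover (H i) U.
Proof.
elim: s T => [|i s IH] T gH covT; first by have [] := covT 1.
have [covi|ncovi] := pselect (coset_cover (H i) T).
  exists i; first exact: mem_head.
  exists T => //; elim: (size (i :: s)) => //= n le_n.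
  exact: leq_trans le_n (leq_addr _ _).
have [b nb] : exists b, forall a, a \in T -> ~ H i (a^-1 * b).
  apply: contrapT => nex; apply: ncovi => g; apply: contrapT => ng.
  by apply: nex; exists g => a aT Ha; apply: ng; exists a.
pose T' := T ++ [seq a * b^-1 * a' | a <- T, a' <- T].
have [|g|j js [U sU covU]] := IH T'.
- by move=> j js; apply: gH; rewrite inE js orbT.
- have [j] := covT g; rewrite inE => /orP[/eqP->|js] [a aT Ha]; last first.
    by exists j => //; exists a; rewrite // mem_cat aT.
  have [j'] := covT (b * (a^-1 * g)).
  rewrite inE => /orP[/eqP->|js] [a' a'T Ha']; last first.
    exists j' => //; exists (a * b^-1 * a').
      by rewrite mem_cat; apply/orP; right; apply: allpairs_f.
    by rewrite !invgM invgK -!mulgA.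
  case: (nb a' a'T); apply/set_mem.
  have := (gH i (mem_head _ _)).2 _ _ (mem_set Ha') (mem_set Ha).
  by rewrite mulgA mulgK.
- exists j; first by rewrite inE js orbT.
  exists U => //; rewrite [size (i :: s)]/= iterSr.
  by move: sU; rewrite size_cat size_allpairs mulnn.
Qed.

(** * Central powers *)

Lemma commute_cycle_set (G : groupType) (x a b : G) :
  cycle_set x a -> cycle_set x b -> commute a b.
Proof.
by move=> [k _ <-] [l _ <-]; rewrite /commute -!expgzD GRing.addrC.
Qed.

(** Pigeonhole on [g * y ^+ i] for [i <= m]: two of these elements lie in the
    same cyclic subgroup, hence commute, and cancelling in their commutation
    relation leaves [commute g (y ^+ (j - i))]. *)
Lemma cyclic_cover_central_power (G : groupType) (m : nat) (x : 'I_m -> G) :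
  (forall g, exists i, cycle_set (x i) g) ->
  forall y g : G, commute g (y ^+ m`!).
Proof.
move=> covG y g.
have [f fP] := choice (fun i : 'I_m.+1 => covG (g * y ^+ i)).
have /injectivePn[i [j neq_ij fij]] : ~~ injectiveb f.
  by apply/injectiveP=> /leq_card; rewrite !card_ord ltnn.
wlog lt_ij : i j neq_ij fij / (i < j)%N.
  move=> wl; case: (ltngtP i j) => [|lt_ji|/val_inj ij]; first exact: wl.
    by apply: (wl j i) => //; rewrite eq_sym.
  by rewrite ij eqxx in neq_ij.
have cij : commute (g * y ^+ i) (g * y ^+ j).
  by apply: commute_cycle_set (fP i) _; rewrite fij.
have cg : commute g (y ^+ (j - i)).
  have de : y ^+ (j - i) * y ^+ i = y ^+ i * y ^+ (j - i).
    by rewrite -!expgnDr addnC.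
  apply: (mulgI (g * y ^+ i)); apply: (mulIg (y ^+ i)); move: cij.
  rewrite (_ : y ^+ j = y ^+ (j - i) * y ^+ i); last first.
    by rewrite -expgnDr subnK // ltnW.
  by rewrite /commute de -!mulgA de => ->.
have /dvdnP[q ->] : (j - i %| m`!)%N.
  apply: dvdn_fact; rewrite subn_gt0 lt_ij /=.
  by rewrite (leq_trans (leq_subr _ _)) // -ltnS.
by rewrite mulnC expgnA; apply: commuteX.
Qed.

(** * Kernels of morphisms *)

Lemma morph1 (G K : groupType) (f : G -> K) :
  {morph f : x y / x * y} -> f 1 = 1.
Proof. by move=> fM; apply: (mulIg (f 1)); rewrite -fM !mul1g. Qed.

Lemma morphV (G K : groupType) (f : G -> K) :
  {morph f : x y / x * y} -> {morph f : x / x^-1}.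
Proof.
by move=> fM x; apply: (mulIg (f x)); rewrite -fM !mulVg (morph1 fM).
Qed.

Lemma morph_expgz (G K : groupType) (f : G -> K) (x : G) (k : int) :
  {morph f : x y / x * y} -> f (expgz x k) = expgz (f x) k.
Proof.
move=> fM; have fX n : f (x ^+ n) = f x ^+ n.
  by elim: n => [|n IH]; rewrite ?(morph1 fM) // !expgS fM IH.
by case: k => n /=; rewrite ?(morphV fM) fX.
Qed.

Definition kernel_subgroup (G K : groupType) (f : G -> K)
  (fM : {morph f : x y / x * y}) : normalSubgroup G.
Proof.
exists [set g | f g = 1]; first split=> [|x y /set_mem /= fx /set_mem /= fy].
- by apply: mem_set; apply: morph1.
- by apply: mem_set; rewrite /= fM (morphV fM) fx fy invg1 mulg1.
- move=> x /set_mem /= fx y; apply: mem_set.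
  by rewrite /= conjgE !fM (morphV fM) fx mul1g mulVg.
Defined.

(** The quotient is isomorphic to the image of [f], which is cyclic as a
    subgroup of a cyclic group; any preimage [g0] of a generator of the image
    generates the quotient. *)
Lemma quotg_kernel_cyclic (G : groupType) (z : G) (f : G -> G)
    (fM : {morph f : x y / x * y}) :
  (forall g, cycle_set z (f g)) -> cyclic_group (quotg (kernel_subgroup fM)).
Proof.
move=> fz; have gf : group_closed [in range f].
  split; first by apply: mem_set; exists 1 => //; apply: morph1.
  move=> _ _ /set_mem[a _ <-] /set_mem[b _ <-]; apply: mem_set.
  by exists (a * b^-1); rewrite // fM (morphV fM).
have [|y fy] := subgroup_of_cyclic gf (x := z).
  by move=> _ [g _ <-].
have [g0 _ fg0] : range f y.
  by rewrite fy; exists 1%R => //; rewrite -[RHS]expg1.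
exists (cosetg (kernel_subgroup fM) g0); apply/seteqP; split=> // u _.
have [g ->] := cosetg_surj u.
have [k _ fk] : cycle_set y (f g) by rewrite -fy; exists g.
exists k => //; rewrite -morph_expgz; last exact: cosetgM.
apply/cosetg_eqP/mem_set => /=.
by rewrite fM (morphV fM) (morph_expgz _ _ fM) fg0 fk mulVg.
Qed.

(** * Transfer to a central cyclic subgroup *)

(** The group [G] is not commutative, but products inside a cyclic subgroup can
    be reordered, since they are governed by the sums of the exponents. *)
Lemma perm_prod_cycle_set (G : groupType) (z : G) (I : eqType) (r s : seq I)
    (F : I -> G) : (forall i, cycle_set z (F i)) -> perm_eq r s ->
  \prod_(i <- r) F i = \prod_(i <- s) F i.
Proof.
move=> Fz rs.
have /choice[e eP] : forall i, exists k, expgz z k = F i.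
  by move=> i; have [k _ Fk] := Fz i; exists k.
have prodE t : \prod_(i <- t) F i = expgz z (\sum_(i <- t) e i)%R.
  by rewrite (big_morph _ (expgzD z) (erefl _)); apply: eq_bigr.
by rewrite !prodE (perm_big _ rs).
Qed.

Section CentralTransfer.
Variables (G : groupType) (z : G).
Hypothesis zC : forall g, commute g z.

Definition central_cycle : normalSubgroup G.
Proof.
exists (cycle_set z); first exact: cycle_set_group.
move=> x /set_mem[k _ <-] y; apply: mem_set; exists k => //.
by rewrite conjgE -(commute_expgz k (zC y)) mulKg.
Defined.

Local Notation Z := central_cycle.

Lemma cosetg_repr (u : quotg Z) : cosetg Z (repr u) = u.
Proof. exact: reprK. Qed.

(** With the transversal given by [repr], left multiplication by [g] sends the
    representative of [u] to the representative of [g u] up to this element of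
    [Z]. *)
Definition transfer_factor (g : G) (u : quotg Z) : G :=
  (repr (cosetg Z g * u))^-1 * (g * repr u).

Lemma transfer_factor_cycle g u : cycle_set z (transfer_factor g u).
Proof.
apply/set_mem/(introT (cosetg_eqP Z _ _)).
by rewrite cosetgM !cosetg_repr.
Qed.

(** The cocycle identity that makes the product of the factors over all cosets
    multiplicative in [g]. *)
Lemma transfer_factorM g h u :
  transfer_factor (g * h) u =
  transfer_factor g (cosetg Z h * u) * transfer_factor h u.
Proof. by rewrite /transfer_factor cosetgM !mulgA mulgK. Qed.

Lemma transfer_factor_id k u : transfer_factor (expgz z k) u = expgz z k.
Proof.
rewrite /transfer_factor (_ : cosetg Z (expgz z k) = 1) ?mul1g.
  by rewrite -(commute_expgz k (zC _)) mulKg.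
rewrite -(morph1 (@cosetgM _ Z)); apply/esym/cosetg_eqP/mem_set; exists k => //.
by rewrite invg1 mul1g.
Qed.

Variable s : seq (quotg Z).
Hypotheses (s_uniq : uniq s) (s_full : forall u, u \in s).

Definition transfer g := \prod_(u <- s) transfer_factor g u.

(** By the cocycle identity, [transfer (g * h)] is the product of
    [transfer h] and of the factors of [g] at the cosets [h u]; the latter run
    over all cosets once, since multiplication by [h] permutes them. *)
Lemma transferM : {morph transfer : g h / g * h}.
Proof.
move=> g h; rewrite /transfer.
under eq_bigr do rewrite transfer_factorM.
rewrite prodgM_commute; last first.
  by move=> u v _ _; apply: commute_cycle_set; apply: transfer_factor_cycle.
congr (_ * _); rewrite -(big_map ( *%g (cosetg Z h)) predT (transfer_factor g)).
apply: perm_prod_cycle_set; first exact: transfer_factor_cycle.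
apply: uniq_perm => //; first by rewrite map_inj_uniq //; apply: mulgI.
move=> u; rewrite s_full; apply/mapP; exists ((cosetg Z h)^-1 * u) => //.
by rewrite mulgA mulgV mul1g.
Qed.

Lemma transfer_cycle g : cycle_set z (transfer g).
Proof.
apply/set_mem; rewrite /transfer; elim/big_ind: _ => [|x y|u _].
- exact: (cycle_set_group z).1.
- exact: group_closedM (cycle_set_group z) _ _.
- exact/mem_set/transfer_factor_cycle.
Qed.

(** Every factor of a central element equals that element, so the exponent is
    the index of [Z]. *)
Lemma transfer_expgz k : transfer (expgz z k) = expgz z k ^+ size s.
Proof.
rewrite /transfer; under eq_bigr do rewrite transfer_factor_id.
by elim: s => [|u t IH]; rewrite ?big_nil // big_cons IH -expgS.
Qed.

End CentralTransfer.

(** * The finite normal subgroup *)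

Lemma card_le_cover (T : choiceType) (A : set T) (s : seq T) :
  (forall a, A a -> a \in s) -> exists2 n, (n <= size s)%N & A #= `I_n.
Proof.
move=> As; pose r := undup [seq a <- s | a \in A].
exists (size r).
  by rewrite (leq_trans (size_undup _)) // size_filter count_size.
rewrite (_ : A = [set` r]).
  have -> : [set` r] = [set` seq_fset tt r].
    by apply/eq_set=> a; rewrite seq_fsetE.
  by apply/card_eq_fsetP; rewrite size_seq_fset undup_id // undup_uniq.
apply/seteqP; split=> a /=; rewrite mem_undup mem_filter.
  by move=> Aa; rewrite mem_set //= As.
by case/andP=> /set_mem.
Qed.

(** [Delta] is the kernel of the transfer. On [Z] the transfer is the power map
    with exponent the index, so [Delta] meets [Z] in the subgroup [W] of
    elements killed by that index, which is cyclic and therefore has at most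
    index many elements. As [Delta] meets each coset of [Z] in an empty set or
    in a coset of [W], its order is at most the square of the index. *)
Lemma central_cycle_quotient (G : groupType) (z : G) (T : seq G) :
  (forall g, commute g z) -> coset_cover (cycle_set z) T ->
  exists Delta : normalSubgroup G,
    (exists2 n : nat, (n <= size T ^ 2)%N & Delta #= `I_n) /\
    cyclic_group (quotg Delta).
Proof.
move=> zC covT; pose Z := central_cycle zC.
pose s := undup [seq cosetg Z a | a <- T].
have s_full u : u \in s.
  have [g ->] := cosetg_surj u; have [a aT Za] := covT g.
  rewrite mem_undup; apply/mapP; exists a => //.
  exact/esym/cosetg_eqP/mem_set.
have fM := transferM (undup_uniq _) s_full.
set f := transfer s in fM.
exists (kernel_subgroup fM); split; last first.
  exact/quotg_kernel_cyclic/transfer_cycle.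
pose W := [set w | cycle_set z w /\ w ^+ size s = 1].
have gW : group_closed [in W].
  have gZ := cycle_set_group z.
  split=> [|v w /set_mem[zv v1] /set_mem[zw w1]]; apply: mem_set.
    by split; [exact/set_mem/gZ.1 | rewrite expg1n].
  split; first by apply/set_mem/gZ.2; apply: mem_set.
  by rewrite expgnFl ?v1 ?w1 ?divgg //; apply: commute_cycle_set zv zw.
have [|w defW] := subgroup_of_cyclic gW (x := z); first by move=> v [].
have w1 : w ^+ size s = 1.
  have [] // : W w; by rewrite defW; exists 1%R.
have s_gt0 : (0 < size s)%N by case: (s) (s_full 1).
(* A representative in [Delta] of the coset [u] when [Delta] meets [u]; for
   the other cosets, the default value 1 only adds superfluous elements to the
   list that covers [Delta]. *)
pose r u := xget 1 [set a | f a = 1 /\ cosetg Z a = u].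
have [|n le_n cardD] := card_le_cover (A := kernel_subgroup fM)
    (s := [seq r u * w ^+ j | u <- s, j <- iota 0 (size s)]).
  move=> a /= fa; have [fr qr] : f (r (cosetg Z a)) = 1 /\
      cosetg Z (r (cosetg Z a)) = cosetg Z a.
    apply: (@xgetPex _ 1 [set b | f b = 1 /\ cosetg Z b = cosetg Z a]).
    by exists a.
  move: qr => /cosetg_eqP; set b := r _ => Zba.
  have : W (b^-1 * a).
    have [k _ ek] := set_mem Zba; split; first by exists k.
    by rewrite -ek -transfer_expgz ek -/f fM (morphV fM) fr fa invg1 mul1g.
  rewrite defW => -[k _ ek].
  have [j js ej] := expgz_mod w k s_gt0.
  have -> : a = b * w ^+ j.
    by rewrite -[LHS](mulKg b^-1) -ek ej w1 expg1z mulg1 invgK.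
  exact: allpairs_f.
exists n => //; apply: leq_trans le_n _.
rewrite size_allpairs size_iota mulnn leq_exp2r //.
by rewrite -(size_map (cosetg Z) T) size_undup.
Qed.

Theorem corollary1p2 :
  exists f : nat -> nat,
    forall (m : nat) (G : groupType),
      (0 < m)%N -> covered_by_cyclic G m ->
      exists Delta : normalSubgroup G,
        (exists2 n : nat, (n <= f m)%N & Delta #= `I_n) /\
        cyclic_group (quotg Delta).
Proof.
(* The iterate bounds the index of some [cycle_set (x i)], starting from the
   single representative 1 of the cosets in the cover; replacing [x i] by its
   central power multiplies the index by at most [m`!], and the order of [Delta]
   is at most the square of the index. *)
exists (fun m => (iter m (fun n => n + n ^ 2) 1 * m`!) ^ 2)%N.
move=> m G _ [C cycC covC].
have [x defC] := choice cycC.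
have covG g : exists i, cycle_set (x i) g.
  have [i _ Cg] : (\bigcup_i C i) g by rewrite covC.
  by exists i; rewrite -defC.
have [||i _ [U sU covU]] := coset_cover_finite_index
    (H := fun i => cycle_set (x i)) (s := enum 'I_m) (T := [:: 1]).
- by move=> i _; apply: cycle_set_group.
- move=> g; have [i xg] := covG g; exists i; first exact: mem_enum.
  by exists 1; rewrite ?mem_head // invg1 mul1g.
rewrite size_enum_ord /= in sU.
have m_gt0 := fact_gt0 m.
have zC g := cyclic_cover_central_power covG (x i) g.
pose T := [seq a * x i ^+ j | a <- U, j <- iota 0 m`!].
have [|Delta [[n le_n cardD] cycD]] := central_cycle_quotient zC (T := T).
  move=> g; have [a aU [k _ xk]] := covU g.
  have [j jm ej] := expgz_mod (x i) k m_gt0.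
  exists (a * x i ^+ j); first exact: allpairs_f.
  by exists (k %/ m`!)%Z => //; rewrite invgM -mulgA -xk ej mulKg.
exists Delta; split=> //; exists n => //; apply: leq_trans le_n _.
by rewrite size_allpairs size_iota leq_exp2r // leq_mul2r sU orbT.
Qed.
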